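(* (1) Fix integers $n \ge 1$, $|k| \le n$ and $b \ge -1$. Let $B_{n,k}$ be the set of words of length $n$ on the letters $0,1,2$ in which the number of $0$'s minus the number of $2$'s equals $k$, and let $\mathbb{Z}/n\mathbb{Z}$ act on $B_{n,k}$ by cyclic rotation. Then $(B_{n,k}, \mathbb{Z}/n\mathbb{Z}, {n;b;q \brack k}_2)$ exhibits the cyclic sieving phenomenon, where $${n;b;q \brack k}_2 = \sum_{i=0}^{\lfloor (n-k)/2\rfloor} q^{i(i+b)} {n \brack i}_q {n-i \brack i+k}_q .$$ (2) Fix integers $n \ge 1$ and $0 \le k \le \frac{n+1}{2}$. Let $C_{n,k}$ be the set of words $w=w_1\cdots w_n$ of length $n$ with $k$ letters $1$ and $n-k$ letters $0$ having no two consecutive $1$'s, not even cyclically (i.e. $w_1=w_n=1$ is also forbidden), and let $\mathbb{Z}/n\mathbb{Z}$ act on $C_{n,k}$ by cyclic rotation. Let $A(x,t) = \begin{bmatrix} 1 & x \\ t & 0\end{bmatrix}$ and $e_{n,k}(q) = [t^k]\,\mathrm{Tr}\big(A(q^{n-1},t)A(q^{n-2},t)\cdots A(1,t)\big)$. Then $(C_{n,k}, \mathbb{Z}/n\mathbb{Z}, e_{n,k}(q))$ exhibits the cyclic sieving phenomenon.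
   Context: $[n]_q = \frac{q^n-1}{q-1}$, $[n]_q! = \prod_{i=1}^n[i]_q$, $[0]_q!=1$, ${n \brack k}_q = \frac{[n]_q!}{[k]_q![n-k]_q!}$ for $n\ge k\ge 0$, with the convention ${m \brack j}_q = 0$ if $j<0$ or $j>m$. $[t^k]F$ denotes the coefficient of $t^k$ in $F$. A triple $(X, C, f(q))$, where $X$ is a finite set, $C$ a finite cyclic group acting on $X$, and $f(q)$ a polynomial with nonnegative integer coefficients, exhibits the cyclic sieving phenomenon if for every $g \in C$, $|X^g| = f(\omega)$, where $X^g$ is the set of fixed points of $g$ and $\omega$ is a complex root of unity whose order equals the order of $g$. *)

(* Defs.v *)
From HB Require Import structures.
From mathcomp Require Import all_boot all_order all_algebra all_fingroup.
From mathcomp Require Import cyclic algC.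

Set Implicit Arguments.
Unset Strict Implicit.
Unset Printing Implicit Defensive.

Import Order.TTheory GRing.Theory Num.Theory.
Local Open Scope ring_scope.

(* Polynomials in q are elements of {poly rat}, with 'X playing the role of q.
   The quotients below are polynomial divisions; qintE and qbinomE show that
   they are exact. *)

Definition qint (n : nat) : {poly rat} := ('X^n - 1) %/ ('X - 1).

Definition qfact (n : nat) : {poly rat} := \prod_(1 <= i < n.+1) qint i.

Definition qbinom (m : nat) (j : int) : {poly rat} :=
  if (0 <= j <= m%:Z) then qfact m %/ (qfact `|j| * qfact (m - `|j|)) else 0.

Lemma qintE n : qint n * ('X - 1) = 'X^n - 1.
Proof.
apply: divpK; rewrite subrX1; exact: dvdp_mulr.
Qed.

Lemma qintD m n : qint (m + n) = qint m + 'X^m * qint n.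
Proof.
have X1 : ('X - 1 : {poly rat}) != 0 by rewrite -(size_poly_eq0) size_XsubC.
apply: (mulIf X1); rewrite mulrDl -mulrA !qintE exprD mulrBr mulr1.
by rewrite [RHS]addrC addrA subrK.
Qed.

Lemma qfactS n : qfact n.+1 = qfact n * qint n.+1.
Proof. by rewrite /qfact big_nat_recr. Qed.

Lemma qfact_dvd m n : qfact m * qfact n %| qfact (m + n).
Proof.
move: {2}(m + n)%N (erefl (m + n)%N) => s.
elim: s m n => [|s IH] [|m] [|n] // Es.
- by rewrite /qfact big_nil mul1r.
- by rewrite {1}/qfact big_nil mul1r add0n.
- by rewrite {2}/qfact big_nil mulr1 addn0.
have {1}-> : (m.+1 + n.+1 = (m.+1 + n).+1)%N by rewrite addnS.
have Emn1 : (m + n.+1 = s)%N by move: Es; rewrite addSn => -[].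
have Em1n : (m.+1 + n = s)%N by move: Es; rewrite addnS => -[].
rewrite [X in _ %| X]qfactS -addnS qintD mulrDr; apply: dvdp_add.
  by rewrite (qfactS m) mulrAC dvdp_mul // Em1n -Emn1 IH.
by rewrite (qfactS n) mulrA [X in _ %| X]mulrCA dvdp_mull // dvdp_mul // IH.
Qed.

Lemma qbinomE (m j : nat) : (j <= m)%N ->
  qbinom m j%:Z * (qfact j * qfact (m - j)) = qfact m.
Proof.
move=> le_jm; rewrite /qbinom lez_nat le_jm /= divpK //.
by rewrite -[X in _ %| qfact X](subnKC le_jm) qfact_dvd.
Qed.

(* Every complex root of unity is algebraic, so evaluating in algC loses
   nothing. *)
Definition cyclic_sieving (gT : finGroupType) (T : finType)
    (to : {action gT &-> T}) (X : {set T}) (C : {group gT})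
    (f : {poly rat}) : Prop :=
  [/\ cyclic C,
      [acts C, on X | to],
      f \is a polyOver Num.nat
    & forall (g : gT) (w : algC), g \in C -> #[g]%g.-primitive_root w ->
        #|'Fix_(X | to)[g]%g|%:R = (map_poly ratr f).[w]].

Section Rotation.

Variables (n : nat) (A : finType).

Definition rotation (w : n.-tuple A) (i : 'Z_n) : n.-tuple A :=
  [tuple of rot i w].

Lemma rotation1 : rotation^~ 1%g =1 id.
Proof. by move=> w; apply: val_inj; rewrite /= rot0. Qed.

Lemma rotationM w : act_morph rotation w.
Proof.
move=> i j; apply: val_inj => /=.
have [n_gt1|n_le1] := ltnP 1 n; last first.
  have rot_id k (s : seq A) : (size s <= 1)%N -> rot k s = s.
    by case: s k => [|x [|y s]] [|k].
  by rewrite !rot_id ?size_rot ?size_tuple.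
have ltn (k : 'Z_n) : (k < n)%N by rewrite -{2}(Zp_cast n_gt1) ltn_ord.
rewrite rot_add_mod ?size_tuple; try exact/ltnW/ltn.
rewrite /= addnC; have ltj := ltn j; have lti := ltn i.
move: (j : nat) (i : nat) ltj lti => {}j {}i ltj lti.
rewrite (Zp_cast n_gt1).
have [le_n|gt_n] := leqP (j + i) n; last first.
  rewrite -{1}(subnK (ltnW gt_n)) modnDr modn_small //.
  rewrite ltn_subLR ?(ltnW gt_n)//.
  by rewrite (leq_ltn_trans _ (_ : j + n < n + n)%N) ?leq_add2l ?ltn_add2r // ltnW.
move: le_n; rewrite leq_eqVlt => /predU1P[->|/modn_small-> //].
by rewrite modnn rot0 -[X in rot X](size_tuple w) rot_size.
Qed.

Canonical rotation_action := TotalAction rotation1 rotationM.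

End Rotation.

Definition words_B (n : nat) (k : int) : {set n.-tuple 'I_3} :=
  [set w : n.-tuple 'I_3 |
     (count_mem (0 : 'I_3) w)%:Z - (count_mem (2 : 'I_3) w)%:Z == k].

(* When b >= -1 and |k| <= n, the integers under the absolute values are
   nonnegative. *)
Definition qtrinom (n : nat) (b k : int) : {poly rat} :=
  \sum_(0 <= i < (`|n%:Z - k|./2).+1)
    'X^(`|i%:Z * (i%:Z + b)|) * qbinom n i%:Z * qbinom (n - i) (i%:Z + k).

(* [path.cycle e w] tests e on all consecutive letters of w and on the pair
   (last letter, first letter); for n = 1 this pair is (w_1, w_1). *)
Definition words_C (n k : nat) : {set n.-tuple 'I_2} :=
  [set w : n.-tuple 'I_2 |
     (count_mem (1 : 'I_2) w == k) &&
     path.cycle (fun x y : 'I_2 => ~~ ((x == 1) && (y == 1))) w].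

Definition matA (R : nzRingType) (x t : R) : 'M[R]_2 :=
  \matrix_(i < 2, j < 2)
    if i == 0 then (if j == 0 then 1 else x) else (if j == 0 then t else 0).

(* In {poly {poly rat}} the outer variable is t and the inner one is q. *)
Definition e_poly (n k : nat) : {poly rat} :=
  (\tr (\prod_(0 <= i < n)
          matA (('X ^+ (n.-1 - i) : {poly rat})%:P) ('X : {poly {poly rat}})))`_k.

(* Main.v *)
(** A rotation g of order d fixes exactly the words u ... u (d copies of u, with
    |u| = m = n / d), so both parts compare an evaluation at a primitive d-th
    root of unity w with a count of words of length m.
    Part (1): by q-Lucas, [n, i]_w is 'C(m, i / d) if d divides i and 0
    otherwise, so the sum becomes the trinomial sum counting the words u; the
    powers of q are evaluated at exponents divisible by d.
    Part (2): the product at w is P^m, where P = A(w^(d-1), t) ... A(1, t).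
    Since det P = - t^d and tr P = 1, the matrices P and A(1, t^d) have the same
    characteristic polynomial, so tr P^m = tr A(1, t^d)^m, which expands as a sum
    of t^(d * count_1(u)) over the cyclic words u of length m without 11. *)

From HB Require Import structures.
Require Import Defs.
From mathcomp Require Import all_boot all_order all_algebra all_fingroup.
From mathcomp Require Import cyclic algC.
From mathcomp Require Import zify ring.

Import Order.TTheory GRing.Theory Num.Theory.
Local Open Scope ring_scope.

Set Implicit Arguments.
Unset Strict Implicit.
Unset Printing Implicit Defensive.

(** * Rotations and periodic words *)

Lemma cyclic_Zp (n : nat) : cyclic (Zp n).
Proof.
by rewrite /Zp; case: ifP => _; rewrite ?Zp_cycle ?cycle_cyclic ?cyclic1.
Qed.

Lemma order_Zp (n : nat) (g : 'Z_n) : (0 < n)%N -> g \in Zp n -> (#[g]%g %| n)%N.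
Proof.
by move=> n_gt0 /order_dvdG; rewrite card_Zp.
Qed.

Lemma rot_le1 (A : Type) (k : nat) (s : seq A) : (size s <= 1)%N -> rot k s = s.
Proof. by case: s k => [|x [|y s]] [|k]. Qed.

(* The fixed points of [g] are those of the subgroup [g] generates, and a
   cyclic group has a single subgroup of each order. *)
Lemma afix_rotation (n : nat) (A : finType) (g : 'Z_n) (w : n.-tuple A) :
    (0 < n)%N -> g \in Zp n ->
  (w \in afix (rotation_action n A) [set g]) = (rot (n %/ #[g]%g) w == w :> seq A).
Proof.
(* The type ['Z_1] has two elements, so [n = 1] is settled apart: every rotation fixes a word of
   length at most one. *)
move=> n_gt0 gZ; have [n_gt1|n_le1] := ltnP 1 n; last first.
  rewrite rot_le1 ?size_tuple // eqxx; apply/afix1P; apply: val_inj => /=.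
  by rewrite rot_le1 ?size_tuple.
set m := (n %/ _)%N; have dvd_gn := order_Zp n_gt0 gZ.
have ord1 : #[Zp1 : 'Z_n]%g = n by rewrite order_Zp1 Zp_cast.
have mn : (m %| n)%N by apply/dvdnP; exists #[g]%g; rewrite mulnC divnK.
have m_gt0 : (0 < m)%N by rewrite divn_gt0 // dvdn_leq.
pose h : 'Z_n := (Zp1 ^+ m)%g.
have ordh : #[h]%g = #[g]%g by rewrite /h orderXdiv ord1 // /m divnA // mulKn.
have gh : (<[g]> = <[h]>)%g.
  apply/eqP; rewrite (@eq_subG_cyclic _ [group of <[Zp1 : 'Z_n]>%g]).
  - by rewrite -!orderE ordh.
  - exact: cycle_cyclic.
  - by rewrite /= -Zp_cycle subsetT.
  - by rewrite /= -Zp_cycle subsetT.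
rewrite -afix_cycle gh afix_cycle.
have rot_h : rot h w = rot m w :> seq A.
  (* When [g] is trivial, [m = n] and [h] reduces to 0; rotating by [n] or by 0 gives the same
     word. *)
  have -> : (h : nat) = (m %% n)%N.
    by rewrite /h Zp_expg /= (modn_small (isT : 1 < (Zp_trunc n).+2)%N)
      mul1n (Zp_cast n_gt1).
  have := dvdn_leq n_gt0 mn; rewrite leq_eqVlt => /orP[/eqP->|/modn_small-> //].
  by rewrite modnn rot0 -{2}(size_tuple w) rot_size.
apply/afix1P/eqP => [/(congr1 val) /= | rw]; first by rewrite rot_h.
by apply: val_inj; rewrite /= rot_h.
Qed.

Definition rep (A : Type) (d : nat) (u : seq A) : seq A := flatten (nseq d u).

Lemma size_rep (A : Type) d (u : seq A) : size (rep d u) = (d * size u)%N.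
Proof. by rewrite size_flatten /shape map_nseq sumn_nseq mulnC. Qed.

Lemma count_rep (A : Type) (a : pred A) d (u : seq A) :
  count a (rep d u) = (d * count a u)%N.
Proof. by rewrite count_flatten map_nseq sumn_nseq mulnC. Qed.

Lemma rep_comm (A : Type) d (u : seq A) : rep d u ++ u = u ++ rep d u.
Proof. by elim: d => [|d IH]; rewrite /rep /= ?cats0 // -catA -/(rep d u) IH. Qed.

(** Comparing prefixes of length [size u] in [s ++ u = u ++ s] shows that [s] begins with [u];
    removing this prefix leaves a shorter word that still commutes with [u]. *)
Lemma commute_rep (A : Type) d (u s : seq A) :
  size s = (d * size u)%N -> s ++ u = u ++ s -> s = rep d u.
Proof.
elim: d s => [|d IH] s; first by move/size0nil.
rewrite mulSn => sz_s comm_s.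
have s_u : take (size u) s = u.
  have := congr1 (take (size u)) comm_s.
  by rewrite [RHS]take_size_cat // takel_cat // sz_s leq_addr.
move: sz_s comm_s; rewrite -(cat_take_drop (size u) s) s_u.
rewrite size_cat => /addnI sz_s; rewrite -catA.
move=> /(congr1 (drop (size u))); rewrite !drop_size_cat // => /(IH _ sz_s).
by rewrite /rep /= => {1}->.
Qed.

Lemma rot_rep (A : Type) d (u : seq A) :
  (0 < d)%N -> rot (size u) (rep d u) = rep d u.
Proof. by case: d => // d _; rewrite {1}/rep /= rot_size_cat rep_comm. Qed.

(** Write [w] as [u ++ v] with [size u = m]. Invariance under the rotation says that [v] and [u]
    commute. *)
Lemma rot_fixed_rep (A : Type) d m (w : seq A) :
    (0 < d)%N -> size w = (d * m)%N -> rot m w = w -> w = rep d (take m w).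
Proof.
case: d => // d _; rewrite mulSn => sz_w rot_w.
have sz_u : size (take m w) = m by rewrite size_takel // sz_w leq_addr.
rewrite -{1}(cat_take_drop m w) /rep /=; congr (_ ++ _).
apply: commute_rep; first by rewrite size_drop sz_w sz_u addKn.
by rewrite cat_take_drop.
Qed.

(** The pair of letters at each junction of two copies of [u] is the closing pair of the cycle
    [u]. *)
Lemma cycle_rep (A : Type) (e : rel A) d (u : seq A) :
  (0 < d)%N -> path.cycle e (rep d u) = path.cycle e u.
Proof.
case: u => [|x p]; first by rewrite /rep; elim: d => // -[].
case: d => // d _; rewrite /rep /=.
elim: d => [|d IH]; first by rewrite cats0.
by rewrite rcons_cat /= -cat_rcons cat_path last_rcons IH andbb.
Qed.

(** The map [rep d] is a bijection between the two sets, with inverse [take m]. The predicate [Q]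
    lives on sequences so that it makes sense for both lengths. *)
Lemma card_rot_fixed (A : finType) (n m d : nat) (Q : pred (seq A)) :
    (0 < d)%N -> n = (d * m)%N ->
  #|[set w : n.-tuple A | Q w & rot m w == w :> seq A]| =
  #|[set u : m.-tuple A | Q (rep d u)]|.
Proof.
move=> d_gt0 ->{n}.
have repP (u : m.-tuple A) : size (rep d u) == (d * m)%N.
  by rewrite size_rep size_tuple.
pose f (u : m.-tuple A) : (d * m).-tuple A := Tuple (repP u).
have f_inj : injective f.
  move=> u v /(congr1 val) /= /(congr1 (take m)).
  case: d d_gt0 {repP f} => // d _; rewrite /rep /=.
  rewrite !take_size_cat ?size_tuple //; exact: val_inj.
rewrite -(card_imset _ f_inj); apply: eq_card => w.
rewrite !inE; apply/andP/imsetP => [[Qw /eqP rw] | [u]].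
  have w_rep := rot_fixed_rep d_gt0 (size_tuple w) rw.
  have uP : size (take m w) == m.
    by rewrite size_takel // size_tuple leq_pmull.
  exists (Tuple uP); last by apply: val_inj.
  by rewrite inE /= -w_rep.
rewrite inE => Qu ->; split=> //=.
by rewrite -{1}(size_tuple u) rot_rep.
Qed.

Lemma card_afix_rotation (A : finType) (n : nat) (g : 'Z_n) (Q : pred (seq A)) :
    (0 < n)%N -> g \in Zp n ->
  #|'Fix_([set w : n.-tuple A | Q w] | rotation_action n A)[g]%g| =
  #|[set u : (n %/ #[g]%g).-tuple A | Q (rep #[g]%g u)]|.
Proof.
move=> n_gt0 gZ; rewrite -(@card_rot_fixed _ n) ?order_gt0 //; last first.
  by rewrite mulnC divnK // order_Zp.
by apply: eq_card => w; rewrite in_setI afix_rotation // !inE.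
Qed.

Lemma acts_rotation (A : finType) (n : nat) (Q : pred (seq A)) :
    (forall i w, Q (rot i w) = Q w) ->
  [acts Zp n, on [set w : n.-tuple A | Q w] | rotation_action n A].
Proof. by move=> Qrot; apply/actsP => g _ w; rewrite !inE /= Qrot. Qed.

Lemma big_tuple_cons (R : Type) (idx : R) (op : Monoid.com_law idx)
    (A : finType) (m : nat) (F : seq A -> R) :
  \big[op/idx]_(u : m.+1.-tuple A) F u =
  \big[op/idx]_(a : A) \big[op/idx]_(u : m.-tuple A) F (a :: u).
Proof.
rewrite pair_big /= (reindex (fun p : A * m.-tuple A => [tuple of p.1 :: p.2])).
  by apply: eq_bigr => -[].
exists (fun u : m.+1.-tuple A => (thead u, [tuple of behead u])) => [[a u] _|u _].
  by congr pair; apply: val_inj.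
by rewrite /= -tuple_eta.
Qed.

(** * Gaussian binomials by the q-Pascal recurrence *)

Section Gauss.

Variables (R : comNzRingType) (q : R).

(** Being free of division, this form of the Gaussian binomial can be evaluated at a root of unity,
    where the quotient of q-factorials may read 0/0. *)
Fixpoint gauss (n i : nat) : R :=
  match n, i with
  | _, 0%N => 1
  | 0%N, _.+1 => 0
  | n'.+1, i'.+1 => gauss n' i' + q ^+ i * gauss n' i
  end.

Lemma gauss0 n : gauss n 0 = 1.
Proof. by case: n. Qed.

Lemma gaussS n i : gauss n.+1 i.+1 = gauss n i + q ^+ i.+1 * gauss n i.+1.
Proof. by []. Qed.

Lemma gauss_small n i : (n < i)%N -> gauss n i = 0.
Proof.
elim: n i => [|n IH] [|i] // lt_ni.
by rewrite gaussS !IH ?mulr0 ?addr0 // ltnW.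
Qed.

Lemma gaussnn n : gauss n n = 1.
Proof. by elim: n => // n IH; rewrite gaussS IH gauss_small // mulr0 addr0. Qed.

End Gauss.

Lemma rmorph_gauss (R S : comNzRingType) (f : {rmorphism R -> S}) q n i :
  f (gauss q n i) = gauss (f q) n i.
Proof.
elim: n i => [|n IH] [|i]; rewrite ?gauss0 ?rmorph1 ?rmorph0 //.
by rewrite !gaussS rmorphD rmorphM rmorphXn !IH.
Qed.

Lemma qint_neq0 n : qint n.+1 != 0.
Proof.
apply/eqP => q0; have := qintE n.+1; rewrite q0 mul0r => /esym/eqP.
by rewrite -size_poly_eq0 size_XnsubC.
Qed.

Lemma qfact_neq0 n : qfact n != 0.
Proof.
elim: n => [|n IH]; first by rewrite /qfact big_nil oner_neq0.
by rewrite qfactS mulf_neq0 ?qint_neq0.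
Qed.

(** After multiplication by the denominator, the two Pascal terms become [qfact n] times [qint i.+1]
    and ['X ^+ i.+1 * qint (n - i)], whose sum is [qfact n * qint n.+1] by [qintD]. *)
Lemma gauss_fact n i : (i <= n)%N ->
  gauss 'X n i * (qfact i * qfact (n - i)) = qfact n.
Proof.
have fact0 : qfact 0 = 1 by rewrite /qfact big_nil.
elim: n i => [|n IH] [|i] // le_in; rewrite ?gauss0 ?fact0 ?mul1r ?subn0 //.
rewrite gaussS subSS mulrDl.
have E1 : gauss 'X n i * (qfact i.+1 * qfact (n - i)) = qfact n * qint i.+1.
  by rewrite -(IH i) // qfactS; ring.
have E2 : 'X ^+ i.+1 * gauss 'X n i.+1 * (qfact i.+1 * qfact (n - i)) =
    qfact n * ('X ^+ i.+1 * qint (n - i)).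
  move: le_in; rewrite ltnS leq_eqVlt => /orP[/eqP->|lt_in].
    have -> : qint (n - n) = 0.
      by rewrite subnn /qint expr0 subrr div0p.
    by rewrite gauss_small // !mulr0 mul0r.
  by rewrite -(IH i.+1) // -(subnSK lt_in) [qfact (n - i.+1).+1]qfactS; ring.
by rewrite E1 E2 -mulrDr -qintD qfactS addSn subnKC.
Qed.

Lemma qbinom_gauss n i : qbinom n i%:Z = gauss 'X n i.
Proof.
have [le_in|lt_ni] := leqP i n; last first.
  by rewrite gauss_small // /qbinom lez_nat leqNgt lt_ni.
have nz : qfact i * qfact (n - i) != 0 by rewrite mulf_neq0 ?qfact_neq0.
by apply: (mulIf nz); rewrite qbinomE // gauss_fact.
Qed.

Lemma qbinom_neg n (j : int) : j < 0 -> qbinom n j = 0.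
Proof. by rewrite /qbinom ltNge => /negbTE->. Qed.

Lemma qbinom_polyOver (S : semiringClosed rat) n (j : int) :
  qbinom n j \is a polyOver S.
Proof.
case: j => [i|i]; last by rewrite qbinom_neg // rpred0.
rewrite -[Posz i]/(i%:Z) qbinom_gauss.
elim: n i => [|n IH] [|i]; rewrite ?gauss0 ?rpred1 //; first exact: rpred0.
by rewrite gaussS rpredD // rpredM // rpredX // polyOverX.
Qed.

(** * Evaluation at a primitive root of unity and the q-Lucas rule *)

Definition evalq (w : algC) : {poly rat} -> algC :=
  horner_eval w \o map_poly ratr.

HB.instance Definition _ w := GRing.RMorphism.copy (evalq w)
  (horner_eval w \o map_poly ratr).

Lemma evalqE w f : evalq w f = (map_poly ratr f).[w].
Proof. by []. Qed.

Lemma evalqX w : evalq w 'X = w.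
Proof. by rewrite evalqE map_polyX hornerX. Qed.

Section PrimitiveRoot.

Variables (d : nat) (w : algC).
Hypothesis prim_w : d.-primitive_root w.

Let d_gt0 : (0 < d)%N := prim_order_gt0 prim_w.

Lemma evalq_qint_neq0 n : (0 < n < d)%N -> evalq w (qint n) != 0.
Proof.
move=> /andP[n_gt0 lt_nd]; apply/eqP => q0.
have := congr1 (evalq w) (qintE n).
rewrite rmorphM !rmorphB rmorphXn rmorph1 /= q0 mul0r evalqX => /esym/eqP.
by rewrite subr_eq0 -(prim_order_dvd prim_w) gtnNdvd.
Qed.

Lemma evalq_qfact_neq0 n : (n < d)%N -> evalq w (qfact n) != 0.
Proof.
elim: n => [|n IH] lt_nd; first by rewrite /qfact big_nil rmorph1 oner_neq0.
by rewrite qfactS rmorphM /= mulf_neq0 ?IH ?evalq_qint_neq0 // ltnW.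
Qed.

Lemma evalq_qfact_eq0 : (1 < d)%N -> evalq w (qfact d) = 0.
Proof.
move=> d_gt1; have w1 : w - 1 != 0.
  by rewrite subr_eq0 -(expr1 w) -(prim_order_dvd prim_w) gtnNdvd.
case: d prim_w d_gt1 => // n prim_wn _; rewrite qfactS rmorphM /=.
have/eqP := congr1 (evalq w) (qintE n.+1).
rewrite rmorphM !rmorphB rmorphXn rmorph1 /= evalqX (prim_expr_order prim_wn).
by rewrite subrr mulf_eq0 (negbTE w1) orbF => /eqP->; rewrite mulr0.
Qed.

(** At [w] the factorial [qfact d] vanishes, while the two factorials in the denominator have index
    below [d] and do not. *)
Lemma gauss_prim_eq0 i : (0 < i < d)%N -> gauss w d i = 0.
Proof.
move=> /andP[i_gt0 lt_id]; have d_gt1 : (1 < d)%N by apply: leq_ltn_trans lt_id.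
have := congr1 (evalq w) (gauss_fact (ltnW lt_id)).
rewrite evalq_qfact_eq0 // !rmorphM /= rmorph_gauss /= evalqX => /eqP.
rewrite !mulf_eq0 (negbTE (evalq_qfact_neq0 lt_id)) orFb.
have lt_did : (d - i < d)%N by rewrite ltn_subrL i_gt0.
by rewrite (negbTE (evalq_qfact_neq0 lt_did)) orbF => /eqP.
Qed.

(** A Pascal rule with step [d]. Row [d] at [w] is 1, 0, ..., 0, 1, which is the base case; the
    induction follows the q-Pascal recurrence. *)
Lemma gauss_addd n i :
  gauss w (n + d) i = gauss w n i + (if (d <= i)%N then gauss w n (i - d) else 0).
Proof.
elim: n i => [|n IH] i.
  rewrite add0n; case: i => [|i].
    by rewrite !gauss0 leqNgt d_gt0 addr0.
  rewrite [gauss w 0 i.+1]/= add0r; case: leqP => [|lt_id].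
    rewrite leq_eqVlt => /orP[/eqP<-|lt_di]; first by rewrite subnn gaussnn.
    by rewrite !gauss_small // subn_gt0.
  by rewrite gauss_prim_eq0 ?lt_id.
case: i => [|i]; first by rewrite !gauss0 leqNgt d_gt0 addr0.
rewrite addSn !gaussS !IH; case: (ltngtP d i.+1) => [lt_di|lt_id|eq_di].
- have le_di : (d <= i)%N by [].
  rewrite le_di subSn // gaussS.
  (* Since [w ^+ d = 1], the recurrences at [i] and at [i - d] carry the same power of [w]. *)
  have -> : w ^+ (i - d).+1 = w ^+ i.+1.
    by rewrite -[in RHS](subnK le_di) -addSn exprD (prim_expr_order prim_w) mulr1.
  by ring.
- by rewrite [(d <= i)%N]leqNgt (ltnW lt_id) !addr0.
(* At the boundary [i.+1 = d] the extra term comes only from the second summand, with factor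
   [w ^+ d = 1]. *)
- rewrite leqNgt -eq_di leqnn subnn !gauss0 (prim_expr_order prim_w) addr0.
  by ring.
Qed.

(** By [gauss_addd], passing from [m] to [m.+1] is the ordinary Pascal rule on the indices divisible
    by [d]. *)
Lemma gauss_lucas m i :
  gauss w (d * m) i = (if (d %| i)%N then 'C(m, i %/ d)%:R else 0).
Proof.
elim: m i => [|m IH] i.
  rewrite muln0; case: i => [|i]; first by rewrite gauss0 dvdn0 div0n.
  case: ifP => // /dvdnP[j ->]; rewrite mulnK //; case: j => [|j].
    by rewrite mul0n gauss0.
  by rewrite gauss_small // muln_gt0.
rewrite mulnS addnC gauss_addd !IH; case: leqP => [le_di|lt_id].
  rewrite -(subnK le_di); move: (i - d)%N => k.
  rewrite addnK dvdn_addl //; case: ifP => [/dvdnP[j ->]|_]; last by rewrite addr0.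
  by rewrite divnDr // divnn d_gt0 mulnK // addn1 binS natrD.
rewrite addr0 divn_small // !bin0; by case: ifP.
Qed.

End PrimitiveRoot.

(** * Ternary words and the q-trinomial coefficients *)

(** Choose the positions of the 2's, then those of the 0's among the rest; formally, an induction
    that splits off the first letter. *)
Lemma card_words3 (m i j : nat) :
  #|[set u : m.-tuple 'I_3 |
      (count_mem (2 : 'I_3) u == i) && (count_mem (0 : 'I_3) u == j)]| =
  ('C(m, i) * 'C(m - i, j))%N.
Proof.
pose F (i j : nat) (u : seq 'I_3) : nat :=
  if (count_mem (2 : 'I_3) u == i) && (count_mem (0 : 'I_3) u == j) then 1 else 0.
rewrite -sum1dep_card big_mkcond -/(\sum_(u : m.-tuple 'I_3) F i j u)%N.
elim: m i j => [|m IH] i j.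
  rewrite (big_pred1 [tuple]) => [|u]; last by apply/esym/eqP; rewrite [u]tuple0.
  by case: i j => [|i] [|j].
rewrite (big_tuple_cons _ _ (F i j)) !big_ord_recl big_ord0 /= addn0.
have E0 (u : m.-tuple 'I_3) : F i j (ord0 :: u) = if j is j'.+1 then F i j' u else 0%N.
  by case: j => [|j]; rewrite /F /= add0n ?andbF.
have E1 (u : m.-tuple 'I_3) : F i j (lift ord0 ord0 :: u) = F i j u by [].
have E2 (u : m.-tuple 'I_3) : F i j (lift ord0 (lift ord0 ord0) :: u) =
    if i is i'.+1 then F i' j u else 0%N.
  by case: i {E0 E1} => [|i].
rewrite (eq_bigr _ (fun u _ => E0 u)) (eq_bigr _ (fun u _ => E1 u)).
rewrite (eq_bigr _ (fun u _ => E2 u)) IH {E0 E1 E2}.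
case: i j => [|i] [|j]; rewrite ?big1_eq ?IH ?bin0 ?subn0 ?addn0 ?add0n //.
- by rewrite !mul1n binS addnC.
- by rewrite !muln1 binS.
(* Pascal applies to the second factor only if [m - i] is a successor; otherwise ['C(m, i.+1)] is 0
   and kills the terms with truncated subtraction. *)
rewrite subSS; have [lt_im|le_mi] := ltnP i m.
  by rewrite -(subnSK lt_im) !binS; ring.
by rewrite binS (@bin_small m i.+1) // !mul0n !add0n.
Qed.

(** The added terms vanish: beyond half of [n - k] the lower index [i + k] exceeds [n - i]. The
    longer range allows a termwise comparison with the count of words. *)
Lemma qtrinom_sum n (b k : int) : `|k| <= n%:Z ->
  qtrinom n b k = \sum_(i < n.+1)
    'X^(`|i%:Z * (i%:Z + b)|) * qbinom n i%:Z * qbinom (n - i) (i%:Z + k).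
Proof.
move=> le_kn; rewrite /qtrinom big_mkord.
rewrite (big_ord_widen n.+1 (fun i => 'X^(`|i%:Z * (i%:Z + b)|) *
  qbinom n i%:Z * qbinom (n - i) (i%:Z + k))); last by lia.
rewrite big_mkcond; apply: eq_bigr => -[i /= lt_in] _.
case: ifP => // lt_i; rewrite {2}/qbinom; case: ifP; rewrite ?mulr0 //; lia.
Qed.

(** Words are grouped by the number [i] of 2's in [rep d u]; the number of 0's is then [i + k], and
    both must be multiples of [d]. *)
Lemma card_words_B_rep (d m : nat) (k : int) : (0 < d)%N ->
  #|[set u : m.-tuple 'I_3 |
      (count_mem (0 : 'I_3) (rep d u))%:Z - (count_mem (2 : 'I_3) (rep d u))%:Z == k]| =
  (\sum_(i < (d * m).+1) if (d %| i) && (0 <= i%:Z + k)%R && (d %| `|(i%:Z + k)%R|)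
    then 'C(m, i %/ d) * 'C(m - i %/ d, `|(i%:Z + k)%R| %/ d) else 0)%N.
Proof.
move=> d_gt0; rewrite -sum1dep_card.
have cP (u : m.-tuple 'I_3) : (d * count_mem (2%R : 'I_3) u < (d * m).+1)%N.
  by rewrite ltnS leq_mul2l -{2}(size_tuple u) count_size orbT.
rewrite (partition_big (fun u => Ordinal (cP u)) xpredT) //=.
apply: eq_bigr => i _; rewrite sum1dep_card.
case: ifP => [/andP[/andP[/dvdnP[i' Ei] ik_ge0] /dvdnP[j' Ej]]|nP].
  rewrite Ej Ei !mulnK // -card_words3; apply: eq_card => u.
  rewrite !inE -val_eqE /= Ei !count_rep; apply/andP/andP => -[].
    by move=> /eqP E1 /eqP E2; split; apply/eqP; nia.
  by move=> /eqP E1 /eqP E2; split; apply/eqP; nia.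
apply: eq_card0 => u; rewrite !inE -val_eqE /= !count_rep.
apply/negP => /andP[/eqP E1 /eqP E2]; move/negP: nP; apply.
rewrite -E2 dvdn_mulr //=; set c0 := count_mem 0%R u in E1 *.
have Ek : (d * count_mem 2%R u)%N%:Z + k = (d * c0)%N%:Z by rewrite -E1 addrC subrK.
by rewrite Ek /= dvdn_mulr.
Qed.

Lemma qtrinom_sieving (d m : nat) (w : algC) (b k : int) :
    d.-primitive_root w -> `|k| <= (d * m)%:Z ->
  (map_poly ratr (qtrinom (d * m) b k)).[w] =
  #|[set u : m.-tuple 'I_3 |
      (count_mem (0 : 'I_3) (rep d u))%:Z - (count_mem (2 : 'I_3) (rep d u))%:Z == k]|%:R.
Proof.
move=> prim_w le_k; have d_gt0 := prim_order_gt0 prim_w.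
rewrite -evalqE qtrinom_sum // card_words_B_rep // rmorph_sum natr_sum /=.
apply: eq_bigr => -[i /= lt_i] _; rewrite !rmorphM rmorphXn /= evalqX.
rewrite qbinom_gauss rmorph_gauss /= evalqX (gauss_lucas prim_w).
case: ifP => [/dvdnP[i' Ei]|_]; last by rewrite mulr0 mul0r.
rewrite Ei mulnK // PoszM -mulrA abszM (exprM w) /=.
(* The exponent of q is a multiple of [i], hence of [d], so this power evaluates to 1. *)
have /eqP -> : w ^+ (i' * d) == 1 by rewrite -(prim_order_dvd prim_w) dvdn_mull.
rewrite expr1n mul1r (mulnC i') -mulnBr -PoszM.
case: leP => [ik_ge0|ik_lt0]; last by rewrite qbinom_neg // rmorph0 mulr0.
rewrite -{1}(gez0_abs ik_ge0) qbinom_gauss rmorph_gauss /= evalqX.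
rewrite (gauss_lucas prim_w); case: ifP => _; last by rewrite mulr0.
by rewrite natrM.
Qed.

(** * Traces of powers of two-by-two matrices *)

Lemma mulmx2E (R : comNzRingType) (M N : 'M[R]_2) i j :
  (M * N) i j = M i 0 * N 0 j + M i 1 * N 1 j.
Proof.
rewrite mxE !big_ord_recl big_ord0 addr0.
by congr (_ + M i _ * N _ j); apply: val_inj.
Qed.

Lemma mx2P (R : nzRingType) (M N : 'M[R]_2) :
    M 0 0 = N 0 0 -> M 0 1 = N 0 1 -> M 1 0 = N 1 0 -> M 1 1 = N 1 1 -> M = N.
Proof.
move=> E00 E01 E10 E11; apply/matrixP=> i j.
have I2 (x : 'I_2) : x = 0 \/ x = 1.
  by case: x => -[|[|//]] lt; [left|right]; apply: val_inj.
by case: (I2 i) (I2 j) => -> [] ->.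
Qed.

Lemma mxtrace2E (R : nzRingType) (M : 'M[R]_2) : \tr M = M 0 0 + M 1 1.
Proof.
rewrite /mxtrace !big_ord_recl big_ord0 addr0.
by congr (_ + M _ _); apply: val_inj.
Qed.

Lemma det2E (R : comNzRingType) (M : 'M[R]_2) :
  \det M = M 0 0 * M 1 1 - M 0 1 * M 1 0.
Proof.
rewrite (expand_det_row _ 0) !big_ord_recl big_ord0 addr0 /cofactor !det_mx11 !mxE.
rewrite /= expr0 expr1 mul1r mulN1r mulrN.
by congr (_ * M _ _ - M _ _ * M _ _); apply: val_inj.
Qed.

Lemma Cayley_Hamilton2 (R : comNzRingType) (M : 'M[R]_2) :
  M * M = \tr M *: M - (\det M)%:M.
Proof.
apply: mx2P; rewrite mulmx2E mxtrace2E det2E !mxE /=; ring.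
Qed.

(** By Cayley-Hamilton the traces of powers satisfy a two-term recurrence whose coefficients are the
    trace and the determinant. *)
Lemma mxtrace_exp_eq (R : comNzRingType) (M N : 'M[R]_2) m :
  \tr M = \tr N -> \det M = \det N -> \tr (M ^+ m) = \tr (N ^+ m).
Proof.
move=> trMN detMN; elim/ltn_ind: m => -[|[|m]] IH; rewrite ?expr0 ?expr1 //.
have rec (K : 'M[R]_2) :
    \tr (K ^+ m.+2) = \tr K * \tr (K ^+ m.+1) - \det K * \tr (K ^+ m).
  rewrite !exprS mulrA Cayley_Hamilton2 mulrBl -scalerAl raddfB /= mxtraceZ.
  by rewrite -[X in _ - \tr X]/(_ *m _) mul_scalar_mx mxtraceZ.
by rewrite !rec !IH // trMN detMN.
Qed.

(** * The matrix product behind [e_poly] *)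

Section MatA.

Variable R : comNzRingType.
Implicit Types (q t x : R) (M : 'M[R]_2).

Lemma matA_mul0 x t M j : (matA x t * M) 0 j = M 0 j + x * M 1 j.
Proof. by rewrite mulmx2E !mxE /= mul1r. Qed.

Lemma matA_mul1 x t M j : (matA x t * M) 1 j = t * M 0 j.
Proof. by rewrite mulmx2E !mxE /= mul0r addr0. Qed.

Lemma det_matA x t : \det (matA x t) = - (x * t).
Proof. by rewrite det2E !mxE /= mulr0 sub0r. Qed.

Definition matG q t n : 'M[R]_2 := \prod_(0 <= i < n) matA (q ^+ (n.-1 - i)) t.

Lemma matG0 q t : matG q t 0 = 1.
Proof. by rewrite /matG big_geq. Qed.

Lemma matGS q t n : matG q t n.+1 = matA (q ^+ n) t * matG q t n.
Proof.
rewrite /matG big_nat_recl //= subn0; congr (_ * _).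
by apply: eq_big_nat => i _; congr (matA (q ^+ _) _); lia.
Qed.

Lemma matG1 q t : matG q t 1 = matA 1 t.
Proof. by rewrite matGS matG0 mulr1. Qed.

(** The exponents are periodic modulo [b], so the [a] leftmost factors form [matG q t a]. *)
Lemma matG_add q t a b : q ^+ b = 1 ->
  matG q t (a + b) = matG q t a * matG q t b.
Proof.
move=> qb; elim: a => [|a IH]; first by rewrite matG0 mul1r.
by rewrite addSn !matGS IH mulrA exprD qb mulr1.
Qed.

Lemma matG_mul q t d m : q ^+ d = 1 -> matG q t (d * m) = matG q t d ^+ m.
Proof.
move=> qd; elim: m => [|m IH]; first by rewrite muln0 matG0.
by rewrite mulnS matG_add ?IH ?exprS // exprM qd expr1n.
Qed.

Lemma det_matG q t n : \det (matG q t n) = (\prod_(0 <= i < n) - q ^+ i) * t ^+ n.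
Proof.
elim: n => [|n IH]; first by rewrite matG0 det1 big_geq // mul1r.
rewrite matGS det_mulmx det_matA IH big_nat_recr //= exprS; ring.
Qed.

(* Conjugating by diag(1, q) trades a factor q in t for a factor q in each x,
   that is, for a cyclic shift of the product. *)
Lemma mxtrace_matG_shift q t n : q ^+ n.+1 = 1 ->
  \tr (matG q (q * t) n.+1) = \tr (matG q t n.+1).
Proof.
move=> qn1; pose D : 'M[R]_2 := diag_mx (\row_j q ^+ j).
(* [H k] has the factors of [matG q t k] with every exponent of [q] raised by one. *)
pose H := fix H k := if k is k'.+1 then matA (q ^+ k) t * H k' else 1 : 'M[R]_2.
have DH k : D * H k = matG q (q * t) k * D.
  elim: k => [|k IH]; first by rewrite matG0 mulr1 mul1r.
  rewrite matGS -mulrA -IH !mulrA; congr (_ * _).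
  by apply: mx2P; rewrite !mulmx2E !mxE /= ?mulr1n ?mulr0n ?exprS; ring.
have HG k : matG q t k.+1 = H k * matA 1 t.
  elim: k => [|k IH]; first by rewrite matG1 mul1r.
  by rewrite matGS IH mulrA.

(* The leading factor of [H n.+1] is [matA 1 t] because [q ^+ n.+1 = 1]; cyclicity of the trace
   moves it to the end. *)
have trH : \tr (H n.+1) = \tr (matG q t n.+1).
  by rewrite HG /= qn1; apply: mxtrace_mulC.
move: (H n.+1) trH (DH n.+1) => K <-; move: (matG _ _ _) => G DK.
rewrite !mxtrace2E; congr (_ + _).
  have := congr1 (fun M : 'M_2 => M 0 0) DK; rewrite !mulmx2E !mxE /=.
  by rewrite mulr1n mulr0n expr0 mul1r mulr1 mul0r mulr0 !addr0 => ->.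
(* Here [q ^+ n] is the inverse of [q] and cancels it on both sides. *)
have := congr1 (fun M : 'M_2 => q ^+ n * M 1 1) DK; rewrite !mulmx2E !mxE /=.
rewrite mulr1n mulr0n expr1 mul0r mulr0 !add0r mulrA -exprSr.
by rewrite [_ 1 1 * q]mulrC mulrA -exprSr qn1 !mul1r => ->.
Qed.

End MatA.

Lemma map_matG (R S : comNzRingType) (f : {rmorphism R -> S}) q t n :
  map_mx f (matG q t n) = matG (f q) (f t) n.
Proof.
elim: n => [|n IH]; first by rewrite !matG0 map_mx1.
rewrite !matGS map_mxM IH; congr (_ * _); apply/matrixP => i j; rewrite !mxE.
by case: ifP; case: ifP; rewrite ?rmorph0 ?rmorph1 ?rmorphXn.
Qed.

(** * Trace and determinant over one period at a primitive root *)

Section TraceAtRoot.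

Variables (F : fieldType) (d : nat) (w : F).
Hypothesis prim_w : d.-primitive_root w.

Local Notation G := (matG w%:P 'X).

Let d_gt0 : (0 < d)%N := prim_order_gt0 prim_w.

Let wd : (w%:P : {poly F}) ^+ d = 1.
Proof. by rewrite -rmorphXn /= (prim_expr_order prim_w). Qed.

(** At t = 0 every factor has first column (1, 0) and zero second row. *)
Lemma matG_coef0 n j :
  (G n.+1 0 0)`_0 = 1 /\ (G n.+1 1 j)`_0 = 0.
Proof.
elim: n j => [|n IH] j.
  rewrite matG1 !mxE /= coef1; split=> //.
  by case: ifP; rewrite ?coefX ?coef0.
have [E00 E10] := IH 0.
rewrite matGS matA_mul0 matA_mul1 coefXM coefD E00 -rmorphXn /= coefCM E10.
by rewrite mulr0 addr0.
Qed.

Lemma size_matG n j :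
  (size (G n.+1 0%R j) <= n.+1)%N /\ (size (G n.+1 1%R j) <= n.+2)%N.
Proof.
elim: n => [|n [IH0 IH1]].
  rewrite matG1 !mxE /=; case: ifP; rewrite ?size_poly1 ?size_polyX ?size_poly0 //.
rewrite matGS matA_mul0 matA_mul1; split.
  rewrite (leq_trans (size_polyD _ _)) // geq_max (leq_trans IH0) //=.
  by rewrite -rmorphXn /= mul_polyC (leq_trans (size_scale_leq _ _)).
by rewrite mulrC (leq_trans (size_polyMleq _ _)) // size_polyX addn2 /= ltnW.
Qed.

(** By [mxtrace_matG_shift] the trace is invariant under replacing t by [w] t; this compares
    coefficients. *)
Lemma mxtrace_matG_coef i :
  w ^+ i * (\tr (G d))`_i = (\tr (G d))`_i.
Proof.
have shift : (\tr (G d)) \Po (w%:P * 'X) = \tr (G d).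
  rewrite -[in RHS](prednK d_gt0) -mxtrace_matG_shift ?prednK //.
  have := map_matG (comp_poly (w%:P * 'X)) w%:P 'X d.
  rewrite /= comp_polyC comp_polyX => <-.
  by rewrite trace_map_mx.
rewrite -[in RHS]shift; move: (\tr _) => p.
rewrite coef_comp_poly.
under eq_bigr => j _ do rewrite exprMn -rmorphXn /= coefCM coefXn.
have [lt_ip|le_pi] := ltnP i (size p).
  rewrite (bigD1 (Ordinal lt_ip)) //= eqxx mulr1 mulrC big1 ?addr0 // => j.
  by rewrite -val_eqE /= eq_sym => /negbTE->; rewrite !mulr0.
rewrite nth_default // mulr0 big1 // => j _.
by rewrite gtn_eqF ?mulr0 // (leq_trans (ltn_ord j)).
Qed.

(* By the previous lemma only the coefficients of t^0 and t^d survive; the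
   latter is excluded by the degree when d > 1. *)
Lemma mxtrace_matG : \tr (G d) = 1.
Proof.
have [d1|d_neq1] := eqVneq d 1%N.
  by rewrite d1 matG1 mxtrace2E !mxE /= addr0.
apply/polyP => -[|i]; rewrite coef1 /=.
  rewrite mxtrace2E coefD -(prednK d_gt0).
  by rewrite !(matG_coef0 _ 1).1 (matG_coef0 _ 1).2 addr0.
have [lt_id|le_di] := ltnP i.+1 d.
  have /eqP := mxtrace_matG_coef i.+1.
  rewrite -subr_eq0 -[X in _ - X]mul1r -mulrBl mulf_eq0 subr_eq0.
  by rewrite -(prim_order_dvd prim_w) gtnNdvd //= => /eqP.
apply: nth_default; apply: leq_trans le_di.
case: d d_gt0 d_neq1 => // -[//|n] _ _; rewrite mxtrace2E.
rewrite (leq_trans (size_polyD _ _)) // geq_max (size_matG _ _).1 /=.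
(* The second-row bound of [size_matG] is one too large here; the entry is t times a first-row entry
   of a shorter product. *)
rewrite matGS matA_mul1 mulrC (leq_trans (size_polyMleq _ _)) //.
by rewrite size_polyX addn2 /= ltnS (size_matG _ _).1.
Qed.

(** This is the factorization of ['X^d - 1] over the powers of [w], evaluated at 0. *)
Lemma prod_opp_prim_root : \prod_(0 <= i < d) - w ^+ i = -1.
Proof.
have /(congr1 (horner^~ 0)) := factor_Xn_sub_1 prim_w.
rewrite horner_prod !hornerE expr0n gtn_eqF //= sub0r => <-.
by apply: eq_bigr => i _; rewrite hornerXsubC sub0r.
Qed.

Lemma det_matG_prim : \det (G d) = - 'X^d.
Proof.
rewrite det_matG -[RHS]mulN1r; congr (_ * _).
rewrite -[RHS](rmorphN1 (polyC : {rmorphism F -> {poly F}})) -prod_opp_prim_root.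
by rewrite rmorph_prod; apply: eq_bigr => i _; rewrite rmorphN rmorphXn.
Qed.

Lemma mxtrace_matG_exp m :
  \tr (G (d * m)) = \tr (matA 1 'X^d ^+ m : 'M[{poly F}]_2).
Proof.
rewrite matG_mul //; apply: mxtrace_exp_eq.
  by rewrite mxtrace_matG mxtrace2E !mxE /= addr0.
by rewrite det_matG_prim det_matA mul1r.
Qed.

End TraceAtRoot.

(** * Matrix powers as sums over walks, and cyclic binary words *)

Section Paths.

Variables (R : comNzRingType) (p : nat) (M : 'M[R]_p.+1).

Fixpoint path_weight (a : 'I_p.+1) (s : seq 'I_p.+1) : R :=
  if s is b :: s' then M a b * path_weight b s' else 1.

Lemma mx_exp_paths m a b :
  (M ^+ m) a b =
  \sum_(u : m.-tuple 'I_p.+1) if last a u == b then path_weight a u else 0.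
Proof.
elim: m a => [|m IH] a.
  rewrite (big_pred1 [tuple]) => [|u]; last by apply/esym/eqP; rewrite [u]tuple0.
  by rewrite expr0 mxE /=; case: eqP.
rewrite exprS mxE (big_tuple_cons _ _
  (fun u => if last a u == b then path_weight a u else 0)) /=.
apply: eq_bigr => c _; rewrite IH mulr_sumr; apply: eq_bigr => u _.
by case: ifP; rewrite ?mulr0.
Qed.

(** A closed walk starts at its last vertex. With [m.+1] steps [u] is nonempty, so its last letter
    does not depend on the default [ord0]. *)
Lemma mxtrace_exp_paths m : \tr (M ^+ m.+1) =
  \sum_(u : m.+1.-tuple 'I_p.+1) path_weight (last ord0 u) u.
Proof.
rewrite /mxtrace (eq_bigr _ (fun a _ => mx_exp_paths m.+1 a a)) exchange_big /=.
apply: eq_bigr => u _.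
rewrite -big_mkcond (big_pred1 (last ord0 u)) // => a /=.
by case: u => -[|c s] //= _; rewrite eq_sym.
Qed.

End Paths.

Definition no11 : rel 'I_2 := fun x y => ~~ ((x == 1) && (y == 1)).

(** The zero entry kills each step from 1 to 1, and each departure from 1 contributes [t];
    departures are the letters of [belast a s]. *)
Lemma path_weight_matA (R : comNzRingType) (t : R) a s :
  path_weight (matA 1 t) a s =
  if path no11 a s then t ^+ count_mem 1 (belast a s) else 0.
Proof.
elim: s a => [|b s IH] a //=; rewrite IH !mxE /no11.
have I2 (x : 'I_2) : x = 0 \/ x = 1.
  by case: x => -[|[|//]] lt; [left|right]; apply: val_inj.
by case: (I2 a) (I2 b) => -> [] -> /=; case: ifP;
  rewrite ?mulr0 ?mul0r ?mul1r ?exprS.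
Qed.

Lemma mxtrace_matA_exp (R : comNzRingType) (t : R) m : (0 < m)%N ->
  \tr (matA 1 t ^+ m) =
  \sum_(u : m.-tuple 'I_2 | path.cycle no11 u) t ^+ count_mem 1 u.
Proof.
case: m => // m _; rewrite mxtrace_exp_paths [RHS]big_mkcond.
apply: eq_bigr => u _; rewrite path_weight_matA (cycle_path ord0).
case: ifP => // _; congr (_ ^+ _).
(* The departure letters are [u] with its last letter moved to the front, so they contain as many
   1's. *)
case: u => -[|c s] //= _; have := congr1 (count_mem 1) (lastI c s).
by rewrite -cats1 count_cat /= addn0 => ->; rewrite addnC.
Qed.

Lemma e_poly_sieving (d m k : nat) (w : algC) : (0 < m)%N ->
    d.-primitive_root w ->
  (map_poly ratr (e_poly (d * m) k)).[w] =
  #|[set u : m.-tuple 'I_2 |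
      (count_mem (1 : 'I_2) (rep d u) == k) && path.cycle no11 (rep d u)]|%:R.
Proof.
move=> m_gt0 prim_w; have d_gt0 := prim_order_gt0 prim_w.
have -> : e_poly (d * m) k = (\tr (matG 'X%:P 'X (d * m)))`_k.
  by rewrite /e_poly /matG; under eq_bigr => i _ do rewrite rmorphXn.
rewrite -evalqE -coef_map /= -trace_map_mx map_matG /= map_polyC map_polyX.
rewrite /= evalqX (mxtrace_matG_exp prim_w).
rewrite mxtrace_matA_exp // coef_sum -sum1dep_card natr_sum.
rewrite big_mkcond [RHS]big_mkcond; apply: eq_bigr => u _.
rewrite cycle_rep // count_rep -exprM coefXn eq_sym /=.
by case: (_ == k); case: path.cycle.
Qed.

(** * Nonnegative integer coefficients, and the conclusion *)

Lemma prod_matA_mxOver (R : comNzRingType) (S : semiringClosed R) n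
    (x : nat -> R) (t : R) : (forall i, x i \in S) -> t \in S ->
  \prod_(0 <= i < n) matA (x i) t \is a mxOver S.
Proof.
move=> Sx St; elim/big_ind: _ => [|M N|i _]; last 1 first.
- apply/mxOverP => a b; rewrite mxE.
  by case: ifP => _; case: ifP => _; rewrite ?rpred0 ?rpred1.
- by apply: mxOver_scalar; rewrite ?rpred0 ?rpred1.
- exact: mxOverM.
Qed.

Lemma e_poly_polyOver (S : semiringClosed rat) n k : e_poly n k \is a polyOver S.
Proof.
(* [S1] handles polynomials in q over [S], and [S2] polynomials in t over [S1]; both are closed
   under sums and products, which gives the trace. *)
pose S1 := GRing.SemiringClosed.clone {poly rat} (polyOver_pred S) _.
pose S2 := GRing.SemiringClosed.clone {poly {poly rat}} (polyOver_pred S1) _.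
suff /polyOverP : \tr (\prod_(0 <= i < n) matA (('X ^+ (n.-1 - i) : {poly rat})%:P)
   ('X : {poly {poly rat}})) \in S2 by apply.
have X2 : ('X : {poly {poly rat}}) \in S2 by apply: (polyOverX S1).
have x2 i : (('X ^+ (n.-1 - i) : {poly rat})%:P) \in S2.
  suff : ('X ^+ (n.-1 - i) : {poly rat})%:P \is a polyOver S1 by [].
  by rewrite polyOverC; apply: (rpredX (S := S1)); apply: (polyOverX S).
have /mxOverP M := prod_matA_mxOver n x2 X2.
by apply: rpred_sum => i _; apply: M.
Qed.

Lemma qtrinom_polyOver (S : semiringClosed rat) n b k :
  qtrinom n b k \is a polyOver S.
Proof.
by apply: rpred_sum => i _; rewrite !rpredM ?qbinom_polyOver ?rpredX ?polyOverX.
Qed.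

Theorem theorem1p2 :
  (forall (n : nat) (k b : int),
     (1 <= n)%N -> `|k| <= n%:Z -> -1 <= b ->
     cyclic_sieving (rotation_action n 'I_3) (words_B n k) (Zp_group n)
       (qtrinom n b k))
  /\
  (forall n k : nat,
     (1 <= n)%N -> (2 * k <= n + 1)%N ->
     cyclic_sieving (rotation_action n 'I_2) (words_C n k) (Zp_group n)
       (e_poly n k)).
Proof.
(* The semiring structure of Num.nat is attached to its underlying predicate and is
   not found through the qualifier. *)
pose natS := GRing.SemiringClosed.clone rat (@Num.nat_num_subdef rat) _.
split=> [n k b n_gt0 le_kn _ | n k n_gt0 _]; split; try exact: cyclic_Zp.
- apply: (@acts_rotation _ n (fun w => (count_mem (0 : 'I_3) w)%:Z -
    (count_mem (2 : 'I_3) w)%:Z == k)) => i w.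
  by rewrite !(seq.permP (permEl (perm_rot i w))).
- exact: (qtrinom_polyOver natS).
- move=> g w gZ prim_w; have dn := order_Zp n_gt0 gZ.
  rewrite (@card_afix_rotation _ n g (fun w => (count_mem (0 : 'I_3) w)%:Z -
    (count_mem (2 : 'I_3) w)%:Z == k)) //.
  rewrite -[n in qtrinom n](divnK dn) mulnC qtrinom_sieving //.
  by rewrite mulnC divnK.
- apply: (@acts_rotation _ n (fun w => (count_mem (1 : 'I_2) w == k) &&
    path.cycle no11 w)) => i w.
  by rewrite rot_cycle (seq.permP (permEl (perm_rot i w))).
- exact: (e_poly_polyOver natS).
- move=> g w gZ prim_w; have dn := order_Zp n_gt0 gZ.
  rewrite (@card_afix_rotation _ n g (fun w => (count_mem (1 : 'I_2) w == k) &&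
    path.cycle no11 w)) //.
  rewrite -[n in e_poly n](divnK dn) mulnC e_poly_sieving //.
  by rewrite divn_gt0 // dvdn_leq.
Qed.
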